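(* Every graph $G$ of order at most seven satisfies \[ \tau_D(G)\le\frac{\Delta(\Delta-1)n+2m}{\Delta^2+1}, \] where $n,m,\Delta$ are the order, size and maximum degree of $G$. Consequently, the graph $H_{2,2}$, which has order eight and violates this inequality, has minimum possible order among all graphs violating the inequality.
   Context: All graphs are finite, simple and undirected (not necessarily connected); the maximum degree of the null graph is taken to be zero. A set $T\subseteq V(G)$ is an identifying vertex cover if $e\cap T\neq\emptyset$ for every $e\in E(G)$ and the sets $e\cap T$ ($e\in E(G)$) are pairwise distinct; $\tau_D(G)$ is the minimum cardinality of an identifying vertex cover of $G$. $H_{2,2}$ is the graph on the eight distinct vertices $a,b,x_1,x_2,c_1,c_2,d_1,d_2$ with exactly the eleven edges $ax_1,\ ax_2,\ bx_1,\ bx_2,\ ac_1,\ ac_2,\ c_1d_1,\ c_2d_2,\ d_1b,\ d_2b,\ d_1d_2$. *)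

(* Defs.v *)
From mathcomp Require Import all_boot all_order all_algebra.

Set Implicit Arguments.
Unset Strict Implicit.
Unset Printing Implicit Defensive.


Record graph := Graph {
  vertex :> finType;
  adj : rel vertex;
  adj_sym : symmetric adj;
  adj_irrefl : irreflexive adj
}.

Section Invariants.
Variable G : graph.

Definition edges : {set {set G}} := [set [set p.1; p.2] | p : G * G & adj p.1 p.2].

Definition gorder : nat := #|G|.
Definition gsize : nat := #|edges|.
Definition degree (v : G) : nat := #|[set w : G | adj v w]|.
Definition max_degree : nat := \max_(v : G) degree v.

Definition identifying_vertex_cover (T : {set G}) : bool :=
  [forall e in edges, e :&: T != set0] &&
  [forall e in edges, forall f in edges, (e != f) ==> (e :&: T != f :&: T)].

Lemma identifying_vertex_cover_setT : identifying_vertex_cover [set: G].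
Proof.
apply/andP; split; apply/forall_inP => e He.
  rewrite setIT; case/imsetP: He => p _ ->.
  by apply/set0Pn; exists p.1; rewrite !inE eqxx.
by apply/forall_inP => f _; apply/implyP; rewrite !setIT.
Qed.

(* The minimum is over a nonempty family: the default [set: G] is itself an
   identifying vertex cover, by the preceding lemma. *)
Definition tauD : nat :=
  #|[arg min_(T < [set: G] | identifying_vertex_cover T) #|T| ]|.

(* The arithmetic is in rat, so Delta - 1 is not truncated at Delta = 0. *)
Definition tauD_bound : bool :=
  (let n : rat := gorder%:R in
   let m : rat := gsize%:R in
   let Delta : rat := max_degree%:R in
   tauD%:R <= (Delta * (Delta - 1) * n + 2 * m) / (Delta ^+ 2 + 1))%R.

End Invariants.

Definition H22_edge_list : seq (nat * nat) :=
  let a := 0 in let b := 1 in let x1 := 2 in let x2 := 3 in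
  let c1 := 4 in let c2 := 5 in let d1 := 6 in let d2 := 7 in
  [:: (a, x1); (a, x2); (b, x1); (b, x2); (a, c1); (a, c2);
      (c1, d1); (c2, d2); (d1, b); (d2, b); (d1, d2)].

Definition H22_adj : rel 'I_8 := fun u v =>
  ((val u, val v) \in H22_edge_list) || ((val v, val u) \in H22_edge_list).

Lemma H22_adj_sym : symmetric H22_adj.
Proof. by move=> u v; rewrite /H22_adj orbC. Qed.

Lemma H22_adj_irrefl : irreflexive H22_adj.
Proof. by case=> [] [|[|[|[|[|[|[|[|i]]]]]]]]. Qed.

Definition H22 : graph := Graph H22_adj_sym H22_adj_irrefl.

(* Main.v *)
(* The complement of an identifying vertex cover is exactly a packing: a set of
   vertices at pairwise distance at least three. With w(v) = Delta + 1 - deg v,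
   the inequality therefore says that some packing S satisfies
   sum_v w(v) <= |S| (Delta^2 + 1).
   If Delta <= 2, take S greedily: a vertex v of minimum degree among the
   remaining ones has degree 0, 1 or Delta, and then the remaining vertices at
   distance at most two from v have total weight at most Delta^2 + 1.
   If Delta >= 3 and n <= 7, two vertices at distance at least three suffice,
   or, when n = 7 and m <= 3, the isolated vertices. If no such pair exists,
   a vertex of degree at most one is handled by the greedy estimate; otherwise
   all degrees are at least two, and the only numerically open case n = 7,
   m = 8 is excluded by counting walks of length two.
   In H_{2,2} any two vertices are at distance at most two, so tau_D = 7. *)
Require Import Defs.
From mathcomp Require Import all_boot all_order all_algebra.
From mathcomp Require Import zify ring.
Import GRing.Theory Num.Theory.

Set Implicit Arguments.
Unset Strict Implicit.
Unset Printing Implicit Defensive.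

Section Packings.
Variable G : graph.
Implicit Types (u v x : G) (A S T : {set G}) (w : G -> nat).

(** * Packings and identifying vertex covers *)

Definition near u v := adj u v || [exists x, adj u x && adj x v].

Definition packing S : Prop := {in S &, forall u v, near u v -> u = v}.

Lemma near_sym : symmetric near.
Proof.
move=> u v; rewrite /near adj_sym; congr orb.
by apply: eq_existsb => x; rewrite andbC adj_sym (adj_sym u).
Qed.

Lemma adj_neq u v : adj u v -> u != v.
Proof. by move=> uv; apply/eqP => E; move: uv; rewrite E adj_irrefl. Qed.

Lemma mem_edges u v : adj u v -> [set u; v] \in edges G.
Proof. by move=> uv; apply/imsetP; exists (u, v); rewrite ?inE. Qed.

Lemma edgesP (e : {set G}) :
  reflect (exists u v, adj u v /\ e = [set u; v]) (e \in edges G).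
Proof.
apply: (iffP imsetP) => [[[u v]]|[u [v [uv ->]]]]; last by exists (u, v); rewrite ?inE.
by rewrite inE => /= uv ->; exists u, v.
Qed.

Lemma set2_eq u v x y : [set u; v] = [set x; y] ->
  (u = x /\ v = y) \/ (u = y /\ v = x).
Proof.
move=> e; have := set21 u v; have := set22 u v; rewrite e !inE.
have := set21 x y; have := set22 x y; rewrite -e !inE.
by do 4![case/orP=> /eqP ?]; subst; auto.
Qed.

(** Adjacent vertices are near, so a packing contains at most one end of an edge. *)
Lemma edge_trace_packing S u v : packing S -> adj u v ->
  [set u; v] :&: ~: S = [set u; v] \/
  exists x y, [/\ [set u; v] = [set x; y], x \in S, y \notin S
                & [set u; v] :&: ~: S = [set y]].
Proof.
move=> pS uv.
have nuv := adj_neq uv.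
have nvu : v != u by rewrite eq_sym.
have trace z (B : {set G}) : (u \in B) = (u \notin S) -> (v \in B) = (v \notin S) ->
    (z \in B -> (z == u) || (z == v)) -> (z \in [set u; v] :&: ~: S) = (z \in B).
  rewrite !inE; case: (eqVneq z u) => [-> ->|_] //=.
  case: (eqVneq z v) => [-> _ ->|_ _ _] //= zB.
  by apply/esym/negP => /zB.
have [uS|uS] := boolP (u \in S); have [vS|vS] := boolP (v \in S).
- by case/eqP: nuv; apply: pS => //; rewrite /near uv.
- right; exists u, v; split=> //; apply/setP => z; apply: trace; rewrite !inE ?uS ?vS ?eqxx ?(negPf nuv) //.
  by move->; rewrite orbT.
- right; exists v, u; split=> //; first by rewrite setUC.
  by apply/setP => z; apply: trace; rewrite !inE ?uS ?vS ?eqxx ?(negPf nvu) // => ->.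
by left; apply/setP => z; apply: trace; rewrite !inE ?uS ?vS ?eqxx ?orbT.
Qed.

(** A two-vertex trace is the edge itself. If two edges leave the same trace [[set y]], their other
    ends lie in [S] and share the neighbour [y], so they coincide. *)
Lemma packing_cover S : packing S -> identifying_vertex_cover (~: S).
Proof.
move=> pS; apply/andP; split; apply/forall_inP => e /edgesP[u [v [uv ->]]].
  have [->|[_ [y [_ _ _ ->]]]] := edge_trace_packing pS uv; apply/set0Pn.
    by exists u; exact: set21.
  by exists y; exact: set11.
apply/forall_inP => f /edgesP[u' [v' [uv' ->]]]; apply/implyP; apply: contraNN => /eqP.
have [->|[x [y [exy xS yS ->]]]] := edge_trace_packing pS uv;
  have [->|[x' [y' [exy' xS' yS' ->]]]] := edge_trace_packing pS uv'.
- by move=> ->.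
- by move/(congr1 (fun B : {set G} => #|B|)); rewrite cards1 cards2 (adj_neq uv).
- by move/(congr1 (fun B : {set G} => #|B|)); rewrite cards1 cards2 (adj_neq uv').
move/set1_inj => E; rewrite exy exy' -E; subst y'.
have adj_xy (a b c d : G) : adj a b -> [set a; b] = [set c; d] -> adj c d.
  by move=> ab /set2_eq[[<- <-]|[<- <-]] //; rewrite adj_sym.
suff -> : x = x' by [].
apply: pS => //; apply/orP; right; apply/existsP; exists y.
by rewrite (adj_xy _ _ _ _ uv exy) adj_sym (adj_xy _ _ _ _ uv' exy').
Qed.

(** Two adjacent vertices outside [T] give an edge with empty trace; two distinct ones with a common
    neighbour [x] give two edges with the same trace [[set x] :&: T]. *)
Lemma cover_packing T : identifying_vertex_cover T -> packing (~: T).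
Proof.
case/andP=> /forall_inP cT /forall_inP dT u v; rewrite !inE => uT vT.
have off x z : x \notin T -> [set x; z] :&: T = [set z] :&: T.
  move=> xT; apply/setP => y; rewrite !inE.
  by have [->|] := eqVneq y x; rewrite // (negPf xT) !andbF.
case/orP=> [uv|/existsP[x /andP[ux xv]]].
  have /negP[] := cT _ (mem_edges uv); rewrite off //.
  by apply/eqP/setP => y; rewrite !inE; have [->|] := eqVneq y v; rewrite // (negPf vT).
apply/eqP/contraT => nuv.
have vx : adj v x by rewrite adj_sym.
have /forall_inP/(_ _ (mem_edges vx))/implyP := dT _ (mem_edges ux).
rewrite !off // eqxx => H; apply: H; apply/eqP => /set2_eq[[E _]|[E F]].
  by rewrite E eqxx in nuv.
by rewrite E -F eqxx in nuv.
Qed.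

(** * The inequality in terms of packings *)

Lemma tauD_cover : exists2 T : {set G}, identifying_vertex_cover T & tauD G = #|T|.
Proof.
by rewrite /tauD; case: arg_minnP => [|T cT _]; [exact: identifying_vertex_cover_setT|exists T].
Qed.

Lemma tauD_min T : identifying_vertex_cover T -> tauD G <= #|T|.
Proof.
by rewrite /tauD; case: arg_minnP => [|? _]; [exact: identifying_vertex_cover_setT|apply].
Qed.

Lemma tauD_packing S : packing S -> tauD G + #|S| <= gorder G.
Proof.
by move=> /packing_cover/tauD_min; rewrite /gorder -(cardsC S); lia.
Qed.

(** Denominators are cleared and the negative term changes sides, so truncated subtraction never
    enters. *)
Lemma tauD_boundE : tauD_bound G =
  (tauD G * (max_degree G ^ 2 + 1) + max_degree G * gorder G
     <= max_degree G ^ 2 * gorder G + 2 * gsize G)%N.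
Proof.
rewrite /tauD_bound; set t := tauD G; set D := max_degree G.
set n := gorder G; set m := gsize G.
rewrite ler_pdivlMr; last by rewrite ltr_wpDl ?exprn_ge0 ?ler0n.
rewrite -(ler_nat rat) !(natrD, natrM, natrX).
by rewrite -[LHS]subr_ge0 -[RHS]subr_ge0; congr (_ <= _)%R; ring.
Qed.

Lemma packing_bound S : packing S ->
  gorder G * (max_degree G).+1 <= 2 * gsize G + #|S| * (max_degree G ^ 2 + 1) ->
  tauD_bound G.
Proof. by move=> /tauD_packing; rewrite tauD_boundE; nia. Qed.

(** * Degree sums *)

Lemma degreeE v : degree v = \sum_(x : G) adj v x.
Proof.
by rewrite /degree -sum1_card big_mkcond; apply: eq_bigr => x _; rewrite inE; case: adj.
Qed.

Lemma sum_nbr_const v k : \sum_(x | adj v x) k = degree v * k.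
Proof. by rewrite sum_nat_const /degree cardsE. Qed.

Lemma handshake : \sum_(v : G) degree v = 2 * gsize G.
Proof.
pose h (p : G * G) := [set p.1; p.2].
transitivity (\sum_(p : G * G | adj p.1 p.2) 1).
  rewrite -(pair_big_dep predT (fun u v => adj u v) (fun _ _ => 1)) /=.
  by apply: eq_bigr => v _; rewrite sum_nbr_const muln1.
rewrite (partition_big h (mem (edges G))) /=; last by move=> [u v] /mem_edges.
rewrite mulnC /gsize -sum_nat_const; apply: eq_bigr => e /edgesP[u [v [uv ->]]].
have nuv := adj_neq uv.
(* The factor 2 is recast as the cardinality of the fibre [[set (u, v); (v, u)]] over the edge. *)
rewrite sum1_card -[RHS]/((true : nat).+1) -[true](_ : (u, v) != (v, u) = true).
  rewrite -cards2; apply: eq_card => -[x y]; rewrite !inE unfold_in /h /=.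
  apply/andP/orP => [[_ /eqP/set2_eq[[-> ->]|[-> ->]]]|[] /eqP[-> ->]];
    rewrite ?eqxx; auto.
  by rewrite adj_sym uv /= setUC.
by rewrite xpair_eqE negb_and nuv.
Qed.

Lemma degree_max v : degree v <= max_degree G.
Proof. exact: leq_bigmax. Qed.

Lemma max_degree_le_sum : max_degree G <= \sum_(v : G) degree v.
Proof. by apply/bigmax_leqP => v _; rewrite (bigD1 v) //= leq_addr. Qed.

(** Each vertex at distance two is charged to every neighbour of [v] that leads to it; multiple
    counting only enlarges the right side. *)
Lemma sum_near_le v A w :
  \sum_(x in A | (x == v) || near v x) w x <=
  w v + \sum_(u | adj v u) (w u + \sum_(x in A | adj u x && (x != v)) w x).
Proof.
rewrite big_split /= (exchange_big_dep predT) //= big_mkcond /=.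
rewrite [X in _ <= _ + (X + _)]big_mkcond /= -big_split /=.
rewrite (bigD1 v) //= [X in _ <= _ + X](bigD1 v) //= addnA; apply: leq_add.
  by case: ifP => _; lia.
apply: leq_sum => x xv; rewrite xv (negPf xv) /near /=.
case: ifP => // /andP[xA /orP[->|/existsP[u /andP[vu ux]]]]; first exact: leq_addr.
by rewrite (bigD1 u) ?vu ?xA ?ux //=; lia.
Qed.

(** * Weights and greedy packings *)

Definition weight v := (max_degree G).+1 - degree v.

Lemma sum_weight : \sum_(v : G) weight v + \sum_(v : G) degree v = gorder G * (max_degree G).+1.
Proof.
rewrite -big_split /= /gorder -sum_nat_const; apply: eq_bigr => v _.
by rewrite subnK // leqW ?degree_max.
Qed.

Lemma sum_second_nbr_le v u A k w : adj v u -> (forall x, x \in A -> w x <= k) ->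
  \sum_(x in A | adj u x && (x != v)) w x <= (degree u).-1 * k.
Proof.
move=> vu wk; apply: (@leq_trans (\sum_(x | adj u x && (x != v)) k)).
  rewrite big_mkcond [X in _ <= X]big_mkcond; apply: leq_sum => x _.
  by case: (boolP (x \in A)) => //= xA; case: ifP => // _; exact: wk.
have : \sum_(x | adj u x) k = k + \sum_(x | adj u x && (x != v)) k.
  by rewrite (bigD1 v) // adj_sym.
by rewrite sum_nbr_const; nia.
Qed.

(* For degrees strictly between 1 and Delta the estimate can fail, e.g. when
   Delta = 3 and [v] has degree 2. *)
Lemma sum_near_weight_le v A :
  {in A, forall x, degree v <= degree x} ->
  degree v <= 1 \/ degree v = max_degree G ->
  \sum_(x in A | (x == v) || near v x) weight x <= max_degree G ^ 2 + 1.
Proof.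
move=> vmin dv; apply: (leq_trans (sum_near_le v A weight)).
set D := max_degree G; set d := degree v in dv vmin.
have key k : (forall u, adj v u -> weight u + (degree u).-1 * weight v <= k) ->
    weight v + \sum_(u | adj v u) (weight u + \sum_(x in A | adj u x && (x != v)) weight x)
    <= weight v + d * k.
  move=> Hk; rewrite leq_add2l -sum_nbr_const; apply: leq_sum => u vu.
  apply: leq_trans (Hk u vu); rewrite leq_add2l; apply: sum_second_nbr_le => // x xA.
  by rewrite leq_sub2l // vmin.
have du u : adj v u -> 0 < degree u <= D.
  move=> vu; rewrite degree_max andbT.
  by apply/card_gt0P; exists v; rewrite inE adj_sym.
case: dv => dv.
  (* For [d = 1] the only neighbour contributes most when its own degree is [D], and the total is D
     + 1 + (D - 1) D = D^2 + 1. *)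
  apply: leq_trans (key (1 + D.-1 * D) _) _ => [u /[dup] vu /du|].
    have : 0 < d by apply/card_gt0P; exists u; rewrite inE.
    by rewrite /weight -/D -/d; nia.
  have := degree_max v; rewrite /weight -/D -/d; case: (d) dv => [|[|//]] _; nia.
(* Here [weight v = 1], so each of the [D] neighbours contributes exactly (D + 1 - deg u) + (deg u -
   1) = D. *)
apply: leq_trans (key D _) _ => [u /du|]; rewrite /weight -/D -/d dv; nia.
Qed.

(** Induction on the size of [A], with degrees and weights always taken in [G]: each chosen vertex
    pays for the weight deleted with it. *)
Lemma greedy_packing A : max_degree G <= 2 ->
  exists S, [/\ S \subset A, packing S
            & \sum_(x in A) weight x <= #|S| * (max_degree G ^ 2 + 1)].
Proof.
move=> D2; have [n] := ubnP #|A|; elim: n A => // n IHn A An.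
have [->|[v0 v0A]] := set_0Vmem A.
  by exists set0; split=> [||]; rewrite ?sub0set ?big_set0 // => u v; rewrite inE.
case: (@arg_minnP _ v0 (fun x => x \in A) (fun x => degree x) v0A) => v vA vmin.
pose B := [set x in A | ~~ ((x == v) || near v x)].
have BA : B \subset A by apply/subsetP => x; rewrite inE => /andP[].
have [|S [SB pS wS]] := IHn B.
  suff: B \proper A by move/proper_card; lia.
  by apply/properP; split=> //; exists v; rewrite // inE eqxx andbF.
have vS : v \notin S by apply/negP => /(subsetP SB); rewrite inE eqxx andbF.
exists (v |: S); split.
- by rewrite subUset sub1set vA (subset_trans SB BA).
- have farv x : x \in S -> ~~ near v x.
    by move=> /(subsetP SB); rewrite inE negb_or => /and3P[].
  move=> x y; rewrite !inE => /orP[/eqP->|xS] /orP[/eqP->|yS] //.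
  + by rewrite (negPf (farv y yS)).
  + by rewrite near_sym (negPf (farv x xS)).
  + exact: pS.
have dv : degree v <= 1 \/ degree v = max_degree G by have := degree_max v; lia.
have wv := sum_near_weight_le vmin dv.
rewrite (bigID (fun x => (x == v) || near v x)) /= cardsU1 vS mulnDl mul1n.
move: wv wS; rewrite [X in _ -> X <= _ -> _](eq_bigl (fun x => (x \in A) && ~~ ((x == v) || near v x))); last first.
  by move=> x; rewrite inE.
lia.
Qed.

Lemma bound_max_degree_le2 : max_degree G <= 2 -> tauD_bound G.
Proof.
move=> D2; have [S [_ pS]] := greedy_packing setT D2.
have -> : \sum_(x in [set: G]) weight x = \sum_(x : G) weight x by apply: eq_bigl => x; rewrite inE.
have := sum_weight; rewrite handshake => E wS.
by apply: (packing_bound pS); lia.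
Qed.

(** * Graphs of order at most seven *)

Lemma packing_isolated : packing [set v : G | degree v == 0].
Proof.
move=> u v; rewrite !inE => /eqP/cards0_eq/setP u0 _.
by case/orP=> [uv|/existsP[x /andP[ux _]]];
  [have := u0 v|have := u0 x]; rewrite !inE ?uv ?ux.
Qed.

(** A vertex of maximum degree accounts for [max_degree G] in the degree sum; any other vertex is
    isolated or adds at least one. *)
Lemma card_isolated :
  0 < gorder G ->
  gorder G + max_degree G <= #|[set v : G | degree v == 0]| + (\sum_(v : G) degree v).+1.
Proof.
move=> n0; have [c Dc] := bigop.eq_bigmax (@degree G) n0; rewrite -/(max_degree G) in Dc.
have split_c (f : G -> nat) : \sum_x f x = f c + \sum_(x | x != c) f x by exact: bigD1.
have -> : #|[set v : G | degree v == 0]| = \sum_(v : G) (degree v == 0).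
  by rewrite -sum1_card big_mkcond; apply: eq_bigr => x _; rewrite inE; case: eqP.
rewrite {1}/gorder -sum1_card Dc !split_c.
suff : \sum_(x | x != c) 1 <= \sum_(x | x != c) (degree x == 0) + \sum_(x | x != c) degree x by lia.
by rewrite -big_split; apply: leq_sum => x _; case: (degree x).
Qed.

(** Walks of length two from [v] reach enough vertices that the degrees of its neighbours sum to at
    least n - 1; summing over [v] counts [degree u] once per neighbour of [u]. *)
Lemma sum_sq_degree : (forall u v, u != v -> near u v) ->
  gorder G * (gorder G).-1 <= \sum_(v : G) degree v ^ 2.
Proof.
move=> nearG.
have ball v : (gorder G).-1 <= \sum_(u | adj v u) degree u.
  have := sum_near_le v setT (fun=> 1).
  rewrite (eq_bigl predT) => [|x]; last first.
    by rewrite inE /=; have [|xv] := eqVneq x v; rewrite //= nearG // eq_sym.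
  rewrite sum1_card -/(gorder G).
  suff : \sum_(u | adj v u) (1 + \sum_(x in [set: G] | adj u x && (x != v)) 1)
    <= \sum_(u | adj v u) degree u by lia.
  apply: leq_sum => u vu.
  have := @sum_second_nbr_le v u setT 1 (fun=> 1) vu (fun _ _ => leqnn _).
  have : 0 < degree u by apply/card_gt0P; exists v; rewrite inE adj_sym.
  lia.
rewrite /gorder -sum_nat_const; apply: leq_trans (leq_sum _ (fun v _ => ball v)) _.
rewrite (exchange_big_dep predT) //=; apply: leq_sum => u _.
rewrite (eq_bigl (adj u)) => [|v]; last exact: adj_sym.
by rewrite sum_nbr_const.
Qed.

Lemma bound_order_le7 : gorder G <= 7 -> tauD_bound G.
Proof.
move=> n7; have [D2|D3] := leqP (max_degree G) 2; first exact: bound_max_degree_le2.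
have hs := handshake; have Dle := max_degree_le_sum.
have n0 : 0 < gorder G.
  rewrite lt0n; apply/eqP => /card0_eq G0.
  by move: D3; rewrite /max_degree big_pred0.
have [/forallP nearG|] := boolP [forall u : G, forall v : G, (u != v) ==> near u v]; last first.
  rewrite negb_forall => /existsP[u]; rewrite negb_forall => /existsP[v].
  rewrite negb_imply => /andP[uv far].
  have p2 : packing [set u; v].
    move=> x y; rewrite !inE => /orP[]/eqP-> /orP[]/eqP-> //; last rewrite near_sym;
    by rewrite (negPf far).
  have := packing_bound p2; rewrite cards2 uv /=.
  have := packing_bound packing_isolated; have := card_isolated n0.
  move: (#|[set _ | _]|) => i.
  (* The pair fails only for n = 7, Delta = 3, m <= 3; then at least three vertices are isolated,
     and 3 * 10 >= 7 * 4. *)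
  by have [m3|m4] := leqP (gsize G) 3; have [?|?] := leqP (max_degree G) 3; nia.
have {}nearG u v : u != v -> near u v by have /forallP/(_ v)/implyP := nearG u.
have /card_gt0P[c0 _] := n0.
case: (@arg_minnP _ c0 predT (fun x => degree x) isT) => v _ vmin.
have p1 : packing [set v] by move=> x y; rewrite !inE => /eqP-> /eqP->.
apply: (packing_bound p1); rewrite cards1 mul1n.
have [dv|dv] := leqP (degree v) 1.
  have := @sum_near_weight_le v setT (fun x _ => vmin x isT) (or_introl dv).
  rewrite (eq_bigl predT) => [|x]; last first.
    by rewrite inE /=; have [|xv] := eqVneq x v; rewrite //= nearG // eq_sym.
  by move=> /= wv; have := sum_weight; rewrite hs; lia.
have d2 x : 2 <= degree x by apply: leq_trans dv (vmin x isT).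
have sum2 : 2 * gorder G + max_degree G <= \sum_(x : G) degree x + 2.
  have [c Dc] := bigop.eq_bigmax (@degree G) n0; rewrite -/(max_degree G) in Dc.
  rewrite Dc mulnC /gorder -sum_nat_const (bigD1 c) //= [X in _ <= X + _](bigD1 c) //=.
  suff : \sum_(i | i != c) 2 <= \sum_(i | i != c) degree i by lia.
  exact: leq_sum.
(* With n <= 7, [sum2] leaves Delta^2 - 6 Delta + 6 >= 0 to check, which holds from Delta = 5 on. *)
have [D5|D4] := leqP 5 (max_degree G); first by nia.
(* Summing (d - 2) (4 - d) >= 0 over all degrees d. *)
have sq : \sum_(x : G) degree x ^ 2 + gorder G * 8 <= 6 * \sum_(x : G) degree x.
  rewrite /gorder -sum_nat_const -big_split big_distrr /=; apply: leq_sum => x _.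
  by have := d2 x; have := degree_max x; nia.
have D34 : max_degree G = 3 \/ max_degree G = 4 by lia.
(* For n <= 6, [sum2] suffices. For n = 7 it gives m >= 8 where m >= 9 is needed, and m = 8 would
   force 42 <= q <= 6 * 16 - 56 = 40. *)
move: (sum_sq_degree nearG) sum2 sq; rewrite hs; move: (\sum_(x : G) degree x ^ 2) => q.
case: D34 => ->; move: (gorder G) n7 (gsize G) => n n7 m;
  by do 8?[case: n n7 => [|n] n7 //]; lia.
Qed.

End Packings.

(** * The graph [H22] *)

Lemma degree_H22 (v : H22) : degree v = nth 0 [:: 4; 4; 2; 2; 2; 2; 3; 3] (val v).
Proof.
rewrite degreeE !big_ord_recl big_ord0.
by case: v => [] [|[|[|[|[|[|[|[|?]]]]]]]].
Qed.

Lemma near_H22 (u v : H22) : u != v -> near u v.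
Proof.
suff H (x y : 'I_8) : H22_adj x y \/ (exists z, H22_adj x z && H22_adj z y) \/ x = y.
  case: (H u v) => [uv _|[[z zP] _|->]]; last by rewrite eqxx.
    by apply/orP; left.
  by apply/orP; right; apply/existsP; exists z.
(* The search over ordinals becomes a check over lists of naturals, settled by evaluation. *)
suff: all (fun i => all (fun j => H22_adj (inord i) (inord j) ||
   (has (fun k => H22_adj (inord i) (inord k) && H22_adj (inord k) (inord j)) (iota 0 8) || (i == j)))
   (iota 0 8)) (iota 0 8).
  have mem8 (z : 'I_8) : (z : nat) \in iota 0 8 by rewrite mem_iota /= ltn_ord.
  move/allP/(_ _ (mem8 x))/allP/(_ _ (mem8 y)); rewrite !inord_val.
  case/or3P=> [|/hasP[k _ kP]|/eqP/val_inj]; auto.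
  by right; left; exists (inord k).
by rewrite /H22_adj /= !inordK.
Qed.

Lemma not_tauD_bound_H22 : ~ tauD_bound H22.
Proof.
have D4 : max_degree H22 = 4.
  by rewrite /max_degree (eq_bigr _ (fun v _ => degree_H22 v)) !big_ord_recl big_ord0.
have m11 : 2 * gsize H22 = 22.
  by rewrite -handshake (eq_bigr _ (fun v _ => degree_H22 v)) !big_ord_recl big_ord0.
have n8 : gorder H22 = 8 by exact: card_ord.
have [T /cover_packing pT tT] := tauD_cover H22.
have T1 : #|~: T| <= 1.
  apply/card_le1_eqP => u v uT vT; have [//|vu] := eqVneq v u.
  exact: (pT v u vT uT (near_H22 vu)).
(* At least seven vertices are in [T], and 7 * 17 + 4 * 8 = 151 exceeds 16 * 8 + 22 = 150. *)
have := cardsC T; rewrite -/(gorder H22) n8 tauD_boundE D4 m11 n8 tT; lia.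
Qed.

Theorem proposition6p1 :
  (forall G : graph, gorder G <= 7 -> tauD_bound G) /\
  [/\ gorder H22 = 8,
      ~ tauD_bound H22 &
      forall G : graph, ~ tauD_bound G -> gorder H22 <= gorder G].
Proof.
have n8 : gorder H22 = 8 by exact: card_ord.
split=> [G|]; first exact: bound_order_le7.
split=> // [|G nG]; first exact: not_tauD_bound_H22.
by rewrite n8 ltnNge; apply/negP => /bound_order_le7.
Qed.
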